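(* Let $k\ge d$. Let ${\mathbb S}=(\mathbf x_1,\dots,\mathbf x_{k-d})\sim D_{\mathcal X}^{k-d}$ and ${\mathbb S}_\circ=(\widetilde{\mathbf x}_1,\dots,\widetilde{\mathbf x}_d)\sim \mathrm{VS}_{D_{\mathcal X}}^d$ be independent, and let $\sigma$ be a uniformly random permutation of $\{1,\dots,k\}$, independent of both. Let $\widetilde{\mathbb S}\in(\mathbb R^d)^k$ be the $k$-tuple obtained by concatenating ${\mathbb S}$ and ${\mathbb S}_\circ$ and permuting the $k$ entries by $\sigma$. Then $\widetilde{\mathbb S}\sim \mathrm{VS}_{D_{\mathcal X}}^k$.
   Context: $D_{\mathcal X}$ is a probability distribution on $\mathbb R^d$ with $\mathbb E\|\mathbf x\|^2<\infty$ and $\boldsymbol\Sigma_{D_{\mathcal X}}:=\mathbb E[\mathbf x\mathbf x^\top]$ invertible. $D_{\mathcal X}^k$ denotes the law of $k$ i.i.d. draws from $D_{\mathcal X}$. For $k\ge d$, volume-rescaled sampling $\mathrm{VS}_{D_{\mathcal X}}^k$ is the probability measure on $(\mathbb R^d)^k$ defined for measurable $A\subseteq(\mathbb R^d)^k$ by $\mathrm{VS}_{D_{\mathcal X}}^k(A)=\dfrac{\mathbb E_{D_{\mathcal X}^k}\big[\mathbf 1_A\,\det\big(\sum_{i=1}^k\mathbf x_i\mathbf x_i^\top\big)\big]}{d!\binom{k}{d}\det(\boldsymbol\Sigma_{D_{\mathcal X}})}$. *)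

(* Defs.v *)
From HB Require Import structures.
From mathcomp Require Import all_boot all_order all_algebra.
From mathcomp Require Import fingroup perm.
From mathcomp Require Import all_classical all_reals all_analysis.
Set Implicit Arguments. Unset Strict Implicit. Unset Printing Implicit Defensive.
Import Order.TTheory GRing.Theory Num.Theory.
Local Open Scope classical_set_scope.
Local Open Scope ring_scope.

(* A point of R^d is a [d.-tuple R]
   (measurable structure: product sigma-algebra of the Borel sets of R,
   provided by the library), a k-tuple of points is a
   [k.-tuple (d.-tuple R)] with the product sigma-algebra. *)

Section VS.
Context {R : realType} {d : nat}.
Local Notation Pt := (d.-tuple R).
Variable D : probability Pt R.

(* E_{D^n}[f] for f : (R^d)^n -> [0,+oo], as the iterated integral
   \int D(dx_1) ... \int D(dx_n) f(x_1,...,x_n)  (Tonelli). *)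
Fixpoint iidE (n : nat) : (n.-tuple Pt -> \bar R) -> \bar R :=
  match n return (n.-tuple Pt -> \bar R) -> \bar R with
  | 0 => fun f => f [tuple]
  | n'.+1 => fun f => (\int[D]_x iidE (fun t => f (cons_tuple x t)))%E
  end.

Definition iidP (n : nat) (A : set (n.-tuple Pt)) : \bar R :=
  iidE (fun t => (\1_A t)%:E).

Definition SigmaD : 'M[R]_d :=
  \matrix_(a, b) fine (\int[D]_x ((tnth x a * tnth x b)%:E))%E.

Definition gram (n : nat) (t : n.-tuple Pt) : 'M[R]_d :=
  \matrix_(a, b) \sum_(i < n) tnth (tnth t i) a * tnth (tnth t i) b.

(* volume-rescaled sampling VS_D^n (meaningful for n >= d) *)
Definition VS (n : nat) (A : set (n.-tuple Pt)) : \bar R :=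
  (iidE (fun t => (\1_A t)%:E * (\det (gram t))%:E) *
   ((d`!%:R * 'C(n, d)%:R * \det SigmaD)^-1)%:E)%E.

End VS.

Definition concat_perm {R : realType} {d k : nat}
  (S : (k - d).-tuple (d.-tuple R)) (S0 : d.-tuple (d.-tuple R))
  (s : {perm 'I_k}) : k.-tuple (d.-tuple R) :=
  [tuple nth [tuple (0:R) | _ < d] (S ++ S0) (s i) | i < k].

(* Main.v *)
Require Import Defs.
From HB Require Import structures.
From mathcomp Require Import all_boot all_order all_algebra.
From mathcomp Require Import fingroup perm.
From mathcomp Require Import all_classical all_reals all_analysis.
From mathcomp Require Import measurable_realfun ring.
Import Order.TTheory GRing.Theory Num.Theory.
Local Open Scope ring_scope.
Set Implicit Arguments.
Unset Strict Implicit.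
Unset Printing Implicit Defensive.

(** Fix the value s of the permutation. The i.i.d. law is a product measure,
    determined by its values on boxes, so concatenating independent i.i.d.
    samples of sizes k - d and d and permuting the entries by s gives the
    i.i.d. law of size k again. Hence, on the event sigma = s, the permuted
    sample has the density det (gram of the d entries coming from S_o) with
    respect to that law, up to a constant. Summing over s turns the density
    into the sum over s of det (gram (t_(s e_1), ..., t_(s e_d))), where e_j
    are the last d positions; it equals d! (k - d)! det (gram t) by the
    Cauchy-Binet formula. *)

(** * Extending partial injections to permutations *)

Lemma perm_extends (I T : finType) (e f : I -> T) :
  injective e -> injective f -> exists u : {perm T}, forall i, u (e i) = f i.
Proof.
move=> e_inj f_inj.
(* For injective [h], [s h] lists [T] without repetition, values of [h] first; [u] matches [s e]
   with [s f] position by position. *)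
pose s (h : I -> T) := codom h ++ [seq x <- enum T | x \notin codom h].
have s_uniq h : injective h -> uniq (s h).
  move=> h_inj; rewrite cat_uniq (map_inj_uniq h_inj) enum_uniq /=.
  rewrite filter_uniq ?enum_uniq// andbT; apply/hasPn => x.
  by rewrite mem_filter => /andP[].
have s_full h x : x \in s h.
  by rewrite mem_cat mem_filter mem_enum andbT orbN.
have s_size h : injective h -> size (s h) = #|T|.
  move=> h_inj; rewrite -(card_uniqP (s_uniq h h_inj)).
  by apply: eq_card => x; rewrite s_full.
pose u x := nth x (s f) (index x (s e)).
have u_inj : injective u.
  move=> x y; rewrite /u (set_nth_default x y) => [/eqP|]; last first.
    by rewrite s_size // -(s_size e) // index_mem.
  rewrite nth_uniq ?s_uniq // ?s_size // -?(s_size e) ?index_mem //.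
  by move=> /eqP exy; rewrite -(nth_index x (s_full e x)) exy nth_index.
exists (perm u_inj) => i; rewrite permE /u /s index_cat codom_f.
rewrite index_map // nth_cat size_codom cardE index_mem mem_enum.
by rewrite (nth_map i) ?index_mem ?mem_enum // nth_index ?mem_enum.
Qed.

(** Fix one such permutation [u]. The others are the products [t * u], with [t] a permutation of the
    complement of the image of [e]. *)
Lemma card_perm_extends (I T : finType) (e f : I -> T) :
  injective e -> injective f ->
  #|[pred u : {perm T} | [forall i, u (e i) == f i]]| = (#|T| - #|I|)`!.
Proof.
move=> e_inj f_inj; have [u ue] := perm_extends e_inj f_inj.
have -> : (#|T| - #|I|)%N = #|[set x | x \notin codom e]|.
  by rewrite -(card_codom e_inj) -(cardC (mem (codom e))) addKn cardsE.
rewrite -card_perm -[RHS](card_imset _ (mulIg u)); apply: eq_card => s.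
rewrite inE; apply/forallP/imsetP => [se|[t te ->] i].
  exists (s * u^-1)%g; last by rewrite mulgKV.
  apply/fintype.subsetP => x; rewrite !inE; apply: contraNN => /codomP[i ->].
  by rewrite permM (eqP (se i)) -ue permK.
rewrite permM -ue (inj_eq perm_inj); apply: contraT => tei.
by have /fintype.subsetP/(_ (e i)) := te; rewrite !inE codom_f => /(_ tei).
Qed.

(** * Cauchy-Binet, summed over permutations *)

Section CauchyBinet.
Variable K : comNzRingType.

(** Cauchy-Binet before the maps [f] are grouped by image: expand by Leibniz, distribute the product
    of sums, and drop each non-injective [f], for which two rows coincide. *)
Lemma det_mulmx_sum_ffun d n (A : 'M[K]_(d, n)) (B : 'M[K]_(n, d)) :
  \det (A *m B) = \sum_(f : {ffun 'I_d -> 'I_n} | injectiveb f)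
    (\prod_i A i (f i)) * \det (rowsub f B).
Proof.
pose AB (s : 'S_d) i j := A i j * B j (s i).
transitivity (\sum_(f : {ffun 'I_d -> 'I_n})
    \sum_(s : 'S_d) (-1) ^+ s * \prod_i AB s i (f i)).
  rewrite exchange_big; apply: eq_bigr => /= s _; rewrite -big_distrr /=.
  congr (_ * _); rewrite -(bigA_distr_bigA (AB s)) /=.
  by apply: eq_bigr => x _; rewrite mxE.
have term (f : {ffun 'I_d -> 'I_n}) :
    \sum_(s : 'S_d) (-1) ^+ s * \prod_i AB s i (f i) =
    (\prod_i A i (f i)) * \det (rowsub f B).
  rewrite big_distrr /=; apply: eq_bigr => s _.
  rewrite mulrCA big_split //=; congr (_ * (_ * _)).
  by apply: eq_bigr => x _; rewrite mxE.
under eq_bigr do rewrite term.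
rewrite (bigID (fun f : {ffun _} => injectiveb f)) /= addrC big1 ?add0r // => f.
move=> /injectivePn[i1 [i2 Di12 Ef12]].
by rewrite (determinant_alternate Di12) ?mulr0 // => j; rewrite !mxE Ef12.
Qed.

(** Expanding each determinant on the left gives a sum over self-maps [g] of ['I_d]. Each of the
    [d!] injective ones contributes the same sum over [s], and an injection [f] is of the form
    [s \o e] for exactly [(n - d)!] permutations [s]. *)
Lemma sum_perm_det_sub d n (A : 'M[K]_(d, n)) (B : 'M[K]_(n, d))
    (e : 'I_d -> 'I_n) : injective e ->
  \sum_(s : 'S_n) \det (colsub (s \o e) A *m rowsub (s \o e) B) =
  (d`! * (n - d)`!)%:R * \det (A *m B).
Proof.
move=> e_inj.
pose h (f : 'I_d -> 'I_n) := (\prod_i A i (f i)) * \det (rowsub f B).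
have eq_h f g : f =1 g -> h f = h g.
  move=> fg; rewrite /h; congr (_ * _).
    by apply: eq_bigr => i _; rewrite fg.
  congr determinant.
  by apply/matrixP => i j; rewrite !mxE fg.
transitivity (\sum_(g : {ffun 'I_d -> 'I_d} | injectiveb g)
    \sum_(s : 'S_n) h (s \o e)).
  transitivity (\sum_(s : 'S_n) \sum_(g : {ffun 'I_d -> 'I_d} | injectiveb g)
      h (s \o e \o g)).
    apply: eq_bigr => s _; rewrite det_mulmx_sum_ffun; apply: eq_bigr => g _.
    congr (_ * _); first by apply: eq_bigr => i _; rewrite mxE.
    congr determinant.
    by apply/matrixP => i j; rewrite !mxE.
  rewrite exchange_big /=; apply: eq_bigr => g /injectiveP g_inj.
  (* A permutation [w] of ['I_n] with [w \o e = e \o g] lets the sum over [s] absorb [g]. *)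
  have [w we] := perm_extends e_inj (inj_comp e_inj g_inj).
  rewrite (reindex_inj (mulgI w^-1%g)) /=; apply: eq_bigr => s _.
  by apply: eq_h => i /=; rewrite permM -[e (g i)]we permK.
rewrite sumr_const -cardsE card_inj_ffuns !card_ord ffactnn.
rewrite -[in LHS]mulr_natl natrM -mulrA; congr (_ * _).
rewrite (partition_big (fun s : 'S_n => [ffun i => s (e i)])
  (fun f : {ffun 'I_d -> 'I_n} => injectiveb f)) /=; last first.
  move=> s _; apply/injectiveP => i j; rewrite !ffunE.
  by move=> /perm_inj /e_inj.
rewrite det_mulmx_sum_ffun big_distrr /=; apply: eq_bigr => f /injectiveP f_inj.
have := card_perm_extends e_inj f_inj; rewrite !card_ord => <-.
rewrite mulr_natl -sumr_const; apply: eq_big => [s|s /eqP <-]; last first.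
  by apply: eq_h => i; rewrite ffunE.
rewrite inE; apply/eqP/forallP => [<- i|se]; first by rewrite ffunE.
by apply/ffunP => i; rewrite ffunE; apply/eqP.
Qed.

End CauchyBinet.

Local Open Scope classical_set_scope.

(** * Boxes generate the product sigma-algebra and determine probabilities *)

Section Boxes.
Context (dT : measure_display) (T : measurableType dT) (n : nat).

Definition box (A : 'I_n -> set T) : set (n.-tuple T) :=
  [set t | forall i, A i (tnth t i)].

Definition boxes : set (set (n.-tuple T)) :=
  [set box A | A in [set A | forall i, measurable (A i)]].

Lemma measurable_box A : (forall i, measurable (A i)) -> measurable (box A).
Proof.
move=> mA.
have -> : box A = \bigcap_(i in [set: 'I_n]) ((@tnth n T ^~ i) @^-1` A i).
  by apply/seteqP; split=> t /= At i; [move=> _|]; apply: At.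
apply: fin_bigcap_measurable => // i _.
by rewrite -[X in measurable X]setTI; apply: measurable_tnth.
Qed.

Lemma boxesT : boxes setT.
Proof. by exists (fun=> setT) => //; apply/seteqP; split. Qed.

Lemma boxes_setI_closed : setI_closed boxes.
Proof.
move=> _ _ [A mA <-] [B mB <-]; exists (fun i => A i `&` B i).
  by move=> i; exact: measurableI.
apply/seteqP; split=> [t /= AB|t /= [At Bt] i]; last by split.
by split=> i; have [] := AB i.
Qed.

Lemma measurable_tuple_boxes :
  (measurable : set (set (n.-tuple T))) = <<s boxes >>.
Proof.
apply/seteqP; split; last first.
  apply: smallest_sub; first exact: sigma_algebra_measurable.
  by move=> _ [A mA <-]; exact: measurable_box.
apply: smallest_sub; first exact: smallest_sigma_algebra.
move=> A; rewrite -bigcup_seq => -[/= i _ [B mB <-]].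
(* A coordinate preimage is a box all of whose other sides are the full space. *)
apply: sub_sigma_algebra; exists (fun j => if j == i then B else setT).
  by move=> j /=; case: ifP.
apply/seteqP; split=> [t /(_ i)|t [_ Bt] j] /=; first by rewrite eqxx.
by case: eqP => // ->.
Qed.

(** Boxes form a generating family that is closed under intersection and contains the whole space,
    so the uniqueness theorem for measures applies. *)
Lemma probability_boxes_unique (R : realType)
    (m1 m2 : probability (n.-tuple T) R) :
  (forall A, (forall i, measurable (A i)) -> m1 (box A) = m2 (box A)) ->
  forall X, measurable X -> m1 X = m2 X.
Proof.
move=> m12; apply: (measure_unique boxes (fun=> setT)).
- exact: measurable_tuple_boxes.
- exact: boxes_setI_closed.
- by move=> _; exact: boxesT.
- by rewrite bigcup_const //; exists 0%N.
- by move=> _ [A mA <-]; exact: m12.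
- by move=> _; rewrite (le_lt_trans (probability_le1 _ _)) // ltry.
Qed.

End Boxes.

(** * The iterated integral as integration against a product law *)

Section IidLaw.
Context {R : realType} {d : nat} (D : probability (d.-tuple R) R).
Local Notation Pt := (d.-tuple R).

(** Replaces [iidE] by an actual measure, so that Tonelli and image measures become available. *)
Definition is_iid_law n (mu : probability (n.-tuple Pt) R) :=
  forall f : n.-tuple Pt -> \bar R, measurable_fun [set: n.-tuple Pt] f ->
    (forall t, 0 <= f t)%E -> iidE D f = (\int[mu]_t f t)%E.

Lemma measurable_cons_tuple (dT : measure_display) (T : measurableType dT) n :
  measurable_fun [set: T * n.-tuple T]
    (fun z : T * n.-tuple T => cons_tuple z.1 z.2).
Proof. exact: (@measurable_cons _ _ _ _ fst n snd). Qed.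

(** By induction: the Dirac mass at the empty tuple, then the image of [D \x mu] under consing;
    Tonelli peels off the outer integral. *)
Lemma exists_iid_law n : exists mu : probability (n.-tuple Pt) R, is_iid_law mu.
Proof.
elim: n => [|n [mu muE]].
  exists (\d_([tuple] : 0.-tuple Pt)) => f mf f0.
  by rewrite integral_dirac // diracT mul1e.
pose cons_mfun : {mfun (Pt * n.-tuple Pt)%type >-> n.+1.-tuple Pt} :=
  mfun_Sub (mem_set (@measurable_cons_tuple _ Pt n)).
exists (distribution (D \x mu)%E cons_mfun) => f mf f0.
have mfc : measurable_fun [set: Pt * n.-tuple Pt] (f \o cons_mfun).
  by apply: measurableT_comp => //; exact: measurable_cons_tuple.
rewrite ge0_integral_distribution // (fubini_tonelli1 _ mfc (fun=> f0 _)).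
apply: eq_integral => x _; apply: muE => //; apply: measurableT_comp => //.
exact: (measurable_fun_pair2 _ (@measurable_cons_tuple _ Pt n)).
Qed.

Lemma iid_lawE n (mu : probability (n.-tuple Pt) R) A :
  is_iid_law mu -> measurable A -> iidP D A = mu A.
Proof.
move=> muE mA; rewrite /iidP muE.
- by rewrite integral_indic // setIT.
- exact/measurable_EFinP/measurable_indic.
- by move=> t; rewrite lee_fin.
Qed.

(** The indicator of a box factors into that of its first side and that of the box of the remaining
    sides. *)
Lemma iidP_box n (A : 'I_n -> set Pt) : (forall i, measurable (A i)) ->
  iidP D (box A) = (\prod_(i < n) D (A i))%E.
Proof.
elim: n A => [|n IHn] A mA.
  by rewrite big_ord0 /iidP /= indicE mem_set // => -[].
rewrite /iidP big_ord_recl /=.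
transitivity (\int[D]_x ((\1_(A ord0) x)%:E *
    iidP D (box (fun i => A (lift ord0 i)))))%E.
  apply: eq_integral => x _; rewrite indicE.
  case: (boolP (x \in A ord0)) => [/set_mem Ax|/negP Ax].
    rewrite mul1e; congr iidE; apply/funext => t; rewrite !indicE.
    congr (_%:R%:E); congr nat_of_bool; apply/idP/idP => /set_mem At.
      by apply/mem_set => i; have := At (lift ord0 i); rewrite tnthS.
    apply/mem_set => i; case: (unliftP ord0 i) => [j ->|->].
      by rewrite tnthS; exact: At.
    by rewrite tnth0.
  rewrite mul0e; have [mu muE] := exists_iid_law n.
  rewrite muE.
  - apply: integral0_eq => t _; rewrite indicE memNset // => At; apply: Ax.
    by apply/mem_set; have := At ord0; rewrite tnth0.
  - apply/measurable_EFinP; apply: measurableT_comp.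
      by apply: measurable_indic; exact: measurable_box.
    exact: (measurable_fun_pair2 _ (@measurable_cons_tuple _ Pt n)).
  - by move=> t; rewrite lee_fin.
have [mu muE] := exists_iid_law n.
have mbox : measurable (box (fun i => A (lift ord0 i))).
  exact: measurable_box.
rewrite ge0_integralZr //.
- by rewrite integral_indic // setIT IHn.
- exact/measurable_EFinP/measurable_indic.
- by rewrite (iid_lawE muE).
Qed.

End IidLaw.

(** * Gram determinants: permutation sums, sign, measurability *)

Section Gram.
Context {R : realType} {d : nat}.
Local Notation Pt := (d.-tuple R).

Definition rows_mx n (t : n.-tuple Pt) : 'M[R]_(n, d) :=
  \matrix_(i, a) tnth (tnth t i) a.

Lemma gramE n (t : n.-tuple Pt) : gram t = (rows_mx t)^T *m rows_mx t.
Proof.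
by apply/matrixP => a b; rewrite !mxE; apply: eq_bigr => i _; rewrite !mxE.
Qed.

Lemma rows_mx_subtuple n (t : n.-tuple Pt) (f : 'I_d -> 'I_n) :
  rows_mx [tuple tnth t (f j) | j < d] = rowsub f (rows_mx t).
Proof. by apply/matrixP => i a; rewrite !mxE tnth_mktuple. Qed.

Lemma sum_perm_det_gram n (t : n.-tuple Pt) (e : 'I_d -> 'I_n) :
  injective e ->
  \sum_(s : 'S_n) \det (gram [tuple tnth t (s (e j)) | j < d]) =
  (d`! * (n - d)`!)%:R * \det (gram t).
Proof.
move=> e_inj; rewrite gramE -(sum_perm_det_sub _ _ e_inj).
apply: eq_bigr => s _; rewrite gramE (rows_mx_subtuple _ (s \o e)).
by congr (\det (_ *m _)); apply/matrixP => i j; rewrite !mxE.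
Qed.

Lemma det_gram_square_ge0 (t : d.-tuple Pt) : 0 <= \det (gram t).
Proof. by rewrite gramE det_mulmx det_tr -expr2 sqr_ge0. Qed.

(** Up to a positive factor the determinant is a sum of Gram determinants of [d] points, each the
    square of a determinant. *)
Lemma det_gram_ge0 n (t : n.-tuple Pt) : (d <= n)%N -> 0 <= \det (gram t).
Proof.
move=> dn; pose e := widen_ord dn.
have e_inj : injective e by move=> i j /(congr1 val) /= /val_inj.
rewrite -(@pmulr_rge0 _ (d`! * (n - d)`!)%:R); last first.
  by rewrite ltr0n muln_gt0 !fact_gt0.
rewrite -(sum_perm_det_gram t e_inj); apply: sumr_ge0 => s _.
exact: det_gram_square_ge0.
Qed.

Lemma measurable_det_gram n :
  measurable_fun [set: n.-tuple Pt] (fun t => \det (gram t)).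
Proof.
(* Leibniz makes the determinant a polynomial in the coordinates. *)
apply: measurable_sum => s; apply: measurable_funM => //.
apply: measurable_prod => a _.
under eq_fun do rewrite mxE.
apply: measurable_sum => i; apply: measurable_funM.
- apply: (measurableT_comp (measurable_tnth a)); exact: measurable_tnth.
- apply: (measurableT_comp (measurable_tnth (s a))); exact: measurable_tnth.
Qed.

End Gram.

(** * Concatenating and permuting i.i.d. samples *)

Section ConcatPerm.
Context {R : realType} {d k : nat} (hkd : (d <= k)%N).
Local Notation Pt := (d.-tuple R).

Definition iid_pos (a : 'I_(k - d)) : 'I_k :=
  cast_ord (subnK hkd) (lshift d a).
Definition vol_pos (b : 'I_d) : 'I_k :=
  cast_ord (subnK hkd) (rshift (k - d) b).

Lemma vol_pos_inj : injective vol_pos.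
Proof. by move=> a b /cast_ord_inj /rshift_inj. Qed.

Lemma pos_ind (Q : 'I_k -> Prop) :
  (forall a, Q (iid_pos a)) -> (forall b, Q (vol_pos b)) -> forall i, Q i.
Proof.
move=> Q1 Q2 i; rewrite -(cast_ordKV (subnK hkd) i).
case: (split_ordP (cast_ord (esym (subnK hkd)) i)) => j ->; first exact: Q1.
exact: Q2.
Qed.

Variable s : {perm 'I_k}.

(** Entry [i] of the result is entry [s i] of the concatenation, so what stood at position [p] lands
    at [s^-1 p]. *)
Lemma tnth_concat_perm_iid S (S0 : d.-tuple Pt) a :
  tnth (concat_perm S S0 s) ((s^-1)%g (iid_pos a)) = tnth S a.
Proof.
by rewrite tnth_mktuple permKV /= nth_cat size_tuple ltn_ord -tnth_nth.
Qed.

Lemma tnth_concat_perm_vol S (S0 : d.-tuple Pt) b :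
  tnth (concat_perm S S0 s) ((s^-1)%g (vol_pos b)) = tnth S0 b.
Proof.
rewrite tnth_mktuple permKV /= nth_cat size_tuple ltnNge leq_addr /= addKn.
by rewrite -tnth_nth.
Qed.

Lemma concat_perm_ind (Q : 'I_k -> Prop) :
  (forall a, Q ((s^-1)%g (iid_pos a))) ->
  (forall b, Q ((s^-1)%g (vol_pos b))) ->
  forall i, Q i.
Proof.
by move=> Q1 Q2 i; rewrite -(permK s i); move: (s i); exact: pos_ind.
Qed.

Definition concat_perm_pair (z : (k - d).-tuple Pt * d.-tuple Pt) :=
  concat_perm z.1 z.2 s.

Lemma measurable_concat_perm :
  measurable_fun [set: (k - d).-tuple Pt * d.-tuple Pt] concat_perm_pair.
Proof.
apply/measurable_fun_tnthP; apply: concat_perm_ind => [a|b].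
- rewrite (_ : _ \o _ = (fun t => tnth t a) \o fst).
    by apply: (measurableT_comp (measurable_tnth a)).
  by apply/funext => z; exact: tnth_concat_perm_iid.
- rewrite (_ : _ \o _ = (fun t => tnth t b) \o snd).
    by apply: (measurableT_comp (measurable_tnth b)).
  by apply/funext => z; exact: tnth_concat_perm_vol.
Qed.

Lemma preimage_concat_perm_box (A : 'I_k -> set Pt) :
  concat_perm_pair @^-1` box A =
  box (fun a => A ((s^-1)%g (iid_pos a))) `*`
  box (fun b => A ((s^-1)%g (vol_pos b))).
Proof.
apply/seteqP; split=> [[S S0] /= At|[S S0] /= [At Bt]].
  split=> [a|b].
    by have := At ((s^-1)%g (iid_pos a)); rewrite tnth_concat_perm_iid.
  by have := At ((s^-1)%g (vol_pos b)); rewrite tnth_concat_perm_vol.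
apply: concat_perm_ind => [a|b].
- by rewrite tnth_concat_perm_iid; exact: At.
- by rewrite tnth_concat_perm_vol; exact: Bt.
Qed.

(** It suffices to compare boxes. The preimage of a box is a product of two boxes, and both masses
    are the product of all [D (A i)], taken in different orders. *)
Lemma iid_law_concat_perm (D : probability Pt R)
    (mu1 : probability ((k - d).-tuple Pt) R)
    (mu2 : probability (d.-tuple Pt) R) (mu : probability (k.-tuple Pt) R) :
  is_iid_law D mu1 -> is_iid_law D mu2 -> is_iid_law D mu ->
  forall A, measurable A ->
    pushforward (mu1 \x mu2)%E concat_perm_pair A = mu A.
Proof.
move=> mu1E mu2E muE.
pose phi : {mfun ((k - d).-tuple Pt * d.-tuple Pt)%type >-> k.-tuple Pt} :=
  mfun_Sub (mem_set measurable_concat_perm).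
apply: (probability_boxes_unique (m1 := distribution (mu1 \x mu2)%E phi)).
move=> A mA.
rewrite -(iid_lawE muE) ?iidP_box //; last exact: measurable_box.
rewrite /distribution /pushforward /= preimage_concat_perm_box.
set A1 := box _; set A2 := box _.
have mA1 : measurable A1 by exact: measurable_box.
have mA2 : measurable A2 by exact: measurable_box.
transitivity (mu1 A1 * mu2 A2)%E; first exact: product_measure1E.
rewrite -(iid_lawE mu1E) // -(iid_lawE mu2E) // !iidP_box //.
rewrite (reindex_inj (@perm_inj _ s^-1%g)) /=.
by rewrite (reindex (cast_ord (subnK hkd))) ?big_split_ord //=; apply: onW_bij;
  exists (cast_ord (esym (subnK hkd))) => i; rewrite ?cast_ordK ?cast_ordKV.
Qed.

End ConcatPerm.

(** * Finite fibres, and densities with respect to the i.i.d. law *)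

Lemma measure_sum_fibers (dO : measure_display) (Omega : measurableType dO)
    (R : realType) (P : {measure set Omega -> \bar R}) (I : finType)
    (f : Omega -> I) (E : set Omega) :
  (forall i, measurable [set w | f w = i]) -> measurable E ->
  P E = (\sum_(i : I) P (E `&` [set w | f w = i]))%E.
Proof.
move=> mf mE.
rewrite [in LHS](_ : E = \bigcup_(i in [set: I]) (E `&` [set w | f w = i]));
  last first.
  by apply/seteqP; split=> [w Ew|w [i _ []]//]; exists (f w).
rewrite measure_fin_bigcup //.
- rewrite (fsbigE (index_enum I)) ?index_enum_uniq // => [|i _]; last first.
    by rewrite mem_index_enum.
  by apply: eq_bigl => i; rewrite in_setT.
- exact: finite_finset.
- by move=> i j _ _ [w [[_ <-] [_ <-]]].
- by move=> i _; exact: measurableI.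
Qed.

Section VSLaw.
Context {R : realType} {d : nat} (D : probability (d.-tuple R) R).
Local Notation Pt := (d.-tuple R).

Definition vol_weight n (A : set (n.-tuple Pt)) (t : n.-tuple Pt) : \bar R :=
  ((\1_A t)%:E * (\det (gram t))%:E)%E.

Lemma vol_weight_ge0 n A (t : n.-tuple Pt) : (d <= n)%N ->
  (0 <= vol_weight A t)%E.
Proof. by move=> dn; rewrite mule_ge0 // lee_fin // det_gram_ge0. Qed.

Lemma measurable_vol_weight n (A : set (n.-tuple Pt)) : measurable A ->
  measurable_fun [set: n.-tuple Pt] (vol_weight A).
Proof.
move=> mA; apply: emeasurable_funM; apply/measurable_EFinP.
- exact: measurable_indic.
- exact: measurable_det_gram.
Qed.

Lemma VS_integral n (mu : probability (n.-tuple Pt) R) A : (d <= n)%N ->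
  is_iid_law D mu -> measurable A ->
  VS D A = (\int[mu]_t vol_weight A t *
    ((d`!%:R * 'C(n, d)%:R * \det (SigmaD D))^-1)%:E)%E.
Proof.
move=> dn muE mA; rewrite /VS muE //; first exact: measurable_vol_weight.
by move=> t; exact: vol_weight_ge0.
Qed.

Context {k : nat} (hkd : (d <= k)%N) (s : {perm 'I_k}).

(** Recovers the volume-sampled block from the permuted tuple, so that its Gram determinant becomes
    a function of that tuple. *)
Definition vol_part (t : k.-tuple Pt) : d.-tuple Pt :=
  [tuple tnth t ((s^-1)%g (vol_pos hkd b)) | b < d].

Lemma vol_part_concat_perm z : vol_part (concat_perm_pair s z) = z.2.
Proof.
by apply: eq_from_tnth => b; rewrite tnth_mktuple tnth_concat_perm_vol.
Qed.

Definition vol_part_weight (A : set (k.-tuple Pt)) (t : k.-tuple Pt) : \bar R :=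
  ((\1_A t)%:E * (\det (gram (vol_part t)))%:E)%E.

Lemma vol_part_weight_ge0 A t : (0 <= vol_part_weight A t)%E.
Proof. by rewrite mule_ge0 // lee_fin // det_gram_ge0. Qed.

Lemma measurable_vol_part_weight A : measurable A ->
  measurable_fun [set: k.-tuple Pt] (vol_part_weight A).
Proof.
move=> mA; apply: emeasurable_funM; apply/measurable_EFinP.
- exact: measurable_indic.
- apply: (measurableT_comp (@measurable_det_gram R d d)).
  apply/measurable_fun_tnthP => b.
  rewrite (_ : _ \o _ =
      fun t : k.-tuple Pt => tnth t ((s^-1)%g (vol_pos hkd b))).
    exact: measurable_tnth.
  by apply/funext => t /=; rewrite tnth_mktuple.
Qed.

(** The density of [nu] sees only the second block, which [vol_part] reads off the permuted tuple.
    The mass is thus an integral over [mu1 \x mu2] of a function of that tuple, whose law there is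
    [mu]. *)
Lemma product_VS_concat_perm (c : R)
    (mu1 : probability ((k - d).-tuple Pt) R)
    (mu2 nu : probability (d.-tuple Pt) R) (mu : probability (k.-tuple Pt) R) :
  is_iid_law D mu1 -> is_iid_law D mu2 -> is_iid_law D mu -> 0 <= c ->
  (forall B, measurable B -> nu B = \int[mu2]_t vol_weight B t * c%:E)%E ->
  forall A, measurable A ->
  (mu1 \x nu)%E (concat_perm_pair s @^-1` A) =
  (\int[mu]_t vol_part_weight A t * c%:E)%E.
Proof.
move=> mu1E mu2E muE c0 nuE A mA.
have mphi := @measurable_concat_perm R d k hkd s.
set C := _ @^-1` A.
have mC : measurable C by rewrite -[C]setTI; exact: mphi.
have F0 z : (0 <= (vol_part_weight A \o concat_perm_pair s) z)%E.
  exact: vol_part_weight_ge0.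
have mF : measurable_fun [set: (k - d).-tuple Pt * d.-tuple Pt]
    (vol_part_weight A \o concat_perm_pair s).
  by apply: measurableT_comp => //; exact: measurable_vol_part_weight.
(* The product measure integrates the [nu]-mass of sections; the density of [nu] turns this into an
   iterated integral. *)
transitivity (\int[mu1]_x
    (fubini_F mu2 (vol_part_weight A \o concat_perm_pair s) x * c%:E))%E.
  apply: eq_integral => x _ /=; rewrite nuE; last exact: measurable_xsection.
  congr (_ * _)%E; apply: eq_integral => y _ /=.
  rewrite /vol_part_weight vol_part_concat_perm /vol_weight !indicE.
  by rewrite mem_xsection.
rewrite ge0_integralZr //; first last.
- by move=> x _; apply: integral_ge0.
- exact: measurable_fun_fubini_tonelli_F.
congr (_ * _)%E; rewrite -(fubini_tonelli1 _ mF F0).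
pose phi : {mfun ((k - d).-tuple Pt * d.-tuple Pt)%type >-> k.-tuple Pt} :=
  mfun_Sub (mem_set mphi).
rewrite [RHS](eq_measure_integral (distribution (mu1 \x mu2)%E phi)).
  by rewrite ge0_integral_distribution //; [exact: measurable_vol_part_weight
    |exact: vol_part_weight_ge0].
by move=> X mX _; apply/esym;
  exact: (iid_law_concat_perm hkd s mu1E mu2E muE mX).
Qed.

End VSLaw.

Lemma sum_integral_vol_part_weight (R : realType) (d k : nat) (hkd : (d <= k)%N)
    (mu : probability (k.-tuple (d.-tuple R)) R) A : measurable A ->
  (\sum_(s : 'S_k) \int[mu]_t vol_part_weight hkd s A t =
   ((d`! * (k - d)`!)%:R)%:E * \int[mu]_t vol_weight A t)%E.
Proof.
move=> mA; rewrite -ge0_integral_sum //; last 2 first.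
- by move=> s; exact: measurable_vol_part_weight.
- by move=> s t _; exact: vol_part_weight_ge0.
rewrite -ge0_integralZl //; last 2 first.
- exact: measurable_vol_weight.
- by move=> t _; exact: vol_weight_ge0.
apply: eq_integral => t _.
rewrite /vol_weight muleCA -(EFinM _ (\det (gram t))).
rewrite -(sum_perm_det_gram t (@vol_pos_inj d k hkd)).
(* [vol_part] reads positions through [s^-1], whereas [sum_perm_det_gram] uses [s]. *)
rewrite (reindex_inj invg_inj) /= -sumEFin ge0_sume_distrr; last first.
  by move=> s _; rewrite lee_fin; exact: det_gram_ge0.
by apply: eq_bigr => s _; rewrite /vol_part_weight /vol_part invgK.
Qed.

(** * Summation over the values of the permutation *)

Theorem theorem1 (R : realType) (d k : nat)
  (D : probability (d.-tuple R) R)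
  (hint : forall a : 'I_d,
     D.-integrable [set: d.-tuple R] (fun x => ((tnth x a) ^+ 2)%:E))
  (hSigma : \det (SigmaD D) != 0)
  (hkd : (d <= k)%N)
  (dO : measure_display) (Omega : measurableType dO)
  (P : probability Omega R)
  (S : Omega -> (k - d).-tuple (d.-tuple R))
  (S0 : Omega -> d.-tuple (d.-tuple R))
  (sigma : Omega -> {perm 'I_k})
  (mS : measurable_fun [set: Omega] S)
  (mS0 : measurable_fun [set: Omega] S0)
  (msigma : forall s : {perm 'I_k}, measurable [set w | sigma w = s])
  (hlaw : forall (A : set ((k - d).-tuple (d.-tuple R)))
                 (B : set (d.-tuple (d.-tuple R))) (s : {perm 'I_k}),
     measurable A -> measurable B ->
     P (S @^-1` A `&` S0 @^-1` B `&` [set w | sigma w = s]) =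
     (iidP D A * VS D B * ((k`!)%:R^-1)%:E)%E) :
  forall A : set (k.-tuple (d.-tuple R)), measurable A ->
    P ((fun w => concat_perm (S w) (S0 w) (sigma w)) @^-1` A) = VS D A.
Proof.
have [mu1 mu1E] := exists_iid_law D (k - d).
have [mu2 mu2E] := exists_iid_law D d.
have [mu muE] := exists_iid_law D k.
have mSS0 : measurable_fun [set: Omega] (fun w => (S w, S0 w)).
  exact: measurable_fun_pair.
have kfact0 : (k`!%:R : R) != 0 by rewrite pnatr_eq0 -lt0n fact_gt0.
(* [VS] is only a set function; the law of [S0] supplies a genuine probability that agrees with it,
   as summing [hlaw] over [s] with [A = setT] shows. *)
pose nu : probability (d.-tuple (d.-tuple R)) R :=
  distribution P
    (mfun_Sub (mem_set mS0) : {mfun Omega >-> d.-tuple (d.-tuple R)}).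
have nuVS B : measurable B -> nu B = VS D B.
  move=> mB; have mSB : measurable (S0 @^-1` B).
    by rewrite -[X in measurable X]setTI; exact: (mS0 measurableT B).
  rewrite [LHS](measure_sum_fibers P msigma mSB).
  transitivity (\sum_(s : {perm 'I_k}) VS D B * ((k`!)%:R^-1)%:E)%E.
    apply: eq_bigr => s _; have := hlaw setT B s measurableT mB.
    by rewrite (iid_lawE mu1E) // probability_setT mul1e preimage_setT setTI.
  rewrite -ge0_sume_distrr => [|s _]; last by rewrite lee_fin invr_ge0.
  by rewrite sumEFin sumr_const card_Sn -[_ *+ _]mulr_natl mulfV // mule1.
pose c := (d`!%:R * 'C(d, d)%:R * \det (SigmaD D))^-1.
have nuE B : measurable B -> (nu B = \int[mu2]_t vol_weight B t * c%:E)%E.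
  by move=> mB; rewrite nuVS // (VS_integral _ mu2E).
(* nu has total mass 1, which is c times a nonnegative integral. *)
have c0 : 0 <= c.
  rewrite leNgt; apply/negP => c0; have := nuE _ measurableT.
  rewrite probability_setT => /eqP; apply/negP.
  rewrite gt_eqF // (@le_lt_trans _ _ 0%E) ?lte01 // mule_ge0_le0 //.
    by apply: integral_ge0 => t _; exact: vol_weight_ge0.
  by rewrite lee_fin ltW.
(* [hlaw] speaks of rectangles only. Restricting [P] to [sigma = s], pushing forward and rescaling
   by [k!] gives a measure with the values of [mu1 \x nu] on rectangles, hence everywhere. *)
have lawE s C : measurable C ->
    P ((fun w => (S w, S0 w)) @^-1` C `&` [set w | sigma w = s]) =
    ((mu1 \x nu) C * ((k`!)%:R^-1)%:E)%E.
  move=> mC.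
  pose m0 : {measure set _ -> \bar R} :=
    pushforward (mrestr P (msigma s)) (fun w => (S w, S0 w)).
  pose m : {measure set _ -> \bar R} :=
    mscale (NngNum (ler0n R k`!)) (m0 mSS0).
  have -> : ((mu1 \x nu) C = m C)%E.
    apply: product_measure_unique => // A B mA mB.
    transitivity ((k`!%:R)%:E *
        P (S @^-1` A `&` S0 @^-1` B `&` [set w | sigma w = s]))%E => //.
    by rewrite hlaw // muleCA -EFinM mulfV // mule1 (iid_lawE mu1E) // -nuVS.
  transitivity ((k`!%:R)%:E * P ((fun w => (S w, S0 w)) @^-1` C `&`
      [set w | sigma w = s]) * (k`!%:R^-1)%:E)%E => //.
  by rewrite muleAC -EFinM mulfV // mul1e.
move=> A mA; set phi := fun w => _.
have mphi : measurable (phi @^-1` A).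
  (* Measurability of [sigma] is given fibre by fibre, so the event is cut into finitely many
     pieces. *)
  rewrite (_ : _ @^-1` _ = \bigcup_(s in [set: {perm 'I_k}])
    ((fun w => (S w, S0 w)) @^-1` (concat_perm_pair s @^-1` A) `&`
     [set w | sigma w = s])).
    apply: fin_bigcup_measurable; first exact: finite_finset.
    move=> s _; apply: measurableI => //.
    rewrite -[X in measurable X]setTI; apply: mSS0 => //.
    by rewrite -[X in measurable X]setTI; exact: measurable_concat_perm.
  apply/seteqP; split=> [w Aw|w [s _ [/= Aw ws]]].
    by exists (sigma w).
  by rewrite /phi /= ws.
rewrite (measure_sum_fibers P msigma mphi).
transitivity (\sum_(s : 'S_k)
    \int[mu]_t vol_part_weight hkd s A t * (c / k`!%:R)%:E)%E.
  apply: eq_bigr => s _.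
  rewrite EFinM muleA -(product_VS_concat_perm hkd s mu1E mu2E muE c0 nuE mA).
  rewrite -(lawE s).
    congr (P _); apply/seteqP; split=> w [/= Aw ws]; split=> //; move: Aw;
      by rewrite /phi /= ws.
  by rewrite -[X in measurable X]setTI; exact: measurable_concat_perm.
rewrite -ge0_sume_distrl; last first.
  by move=> s _; apply: integral_ge0 => t _; exact: vol_part_weight_ge0.
rewrite sum_integral_vol_part_weight // (VS_integral _ muE) //.
rewrite muleAC -EFinM muleC; congr (_ * _%:E)%E.
(* The constants agree because [k! = 'C(k, d) * d! * (k - d)!]: the factor [d! (k - d)! c / k!] is
   the normalisation of [VS] at [k]. *)
rewrite /c binn mulr1 -(bin_fact hkd) !natrM.
have fd : (d`!%:R : R) != 0 by rewrite pnatr_eq0 -lt0n fact_gt0.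
have fkd : ((k - d)`!%:R : R) != 0 by rewrite pnatr_eq0 -lt0n fact_gt0.
have bkd : ('C(k, d)%:R : R) != 0 by rewrite pnatr_eq0 -lt0n bin_gt0.
field.
by rewrite fd fkd bkd hSigma.
Qed.
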